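(* Assume every $(\sigma,\delta)$-conjugacy class of $\mathbb{F}$ is algebraic. Let $a\in\mathbb{F}$, $r\in\mathbb{Z}_+$, let $P=F_{C^{\sigma,\delta}(a)}$, and let $a_1,\dots,a_m\in C^{\sigma,\delta}(a)$ form a P-basis of $C^{\sigma,\delta}(a)$. Then: (1) if $\mathbf b=(b_1,\dots,b_r)$ is a $(\sigma,\delta)$-multiplicity sequence with $b_1\in C^{\sigma,\delta}(a)$, then $P_{\mathbf b}$ divides $P^r$ on the right; (2) if $\mathbf a_i=(a_{i,1},\dots,a_{i,r})$ are $(\sigma,\delta)$-multiplicity sequences with $a_{i,1}=a_i$ ($i=1,\dots,m$) and $\Omega=\{P_{\mathbf a_1},\dots,P_{\mathbf a_m}\}$, then $F_\Omega=P^r$; (3) the set $C^{\sigma,\delta}_r(a)=\{P_{\mathbf b}:\mathbf b\in\mathbb{F}^i\text{ a }(\sigma,\delta)\text{-multiplicity sequence},\ b_1\in C^{\sigma,\delta}(a),\ 1\le i\le r\}\subseteq\mathcal U_2$ is P-closed in $\mathcal U_2$, has minimal skew polynomial $P^r$, has $\Omega$ (from (2)) as a P-basis, and its rank $\deg(P^r)$ equals $r\cdot\deg(F_{C^{\sigma,\delta}(a)})$.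
   Context: Let $\mathbb{F}$ be a division ring, $\sigma$ a ring endomorphism and $\delta$ a $\sigma$-derivation; $\mathbb{F}[x;\sigma,\delta]$ is the skew polynomial ring with $xa=\sigma(a)x+\delta(a)$. Conjugation $a^\beta=\sigma(\beta)a\beta^{-1}+\delta(\beta)\beta^{-1}$, $C^{\sigma,\delta}(a)=\{a^\beta:\beta\in\mathbb{F}^*\}$. For $\mathbf a=(a_1,\dots,a_r)$, $P_{\mathbf a}=(x-a_r)\cdots(x-a_1)$; $\mathbf a$ is a $(\sigma,\delta)$-multiplicity sequence if $a_1$ is the only $b$ with $x-b$ right-dividing $P_{\mathbf a}$. $\mathcal U_2$ is the set of all $P_{\mathbf a}$ with $\mathbf a$ a multiplicity sequence of any length $\ge1$. For a set $\Omega$ of skew polynomials, $I(\Omega)$ is the left ideal of skew polynomials right-divisible by all elements of $\Omega$, $F_\Omega$ its monic generator of minimal degree (or $0$); for $S\subseteq\mathbb{F}$, $F_S=F_{\{x-b:b\in S\}}$; $S$ or $\Omega$ is algebraic if $I\ne\{0\}$. $\Omega$ is P-independent if finite, algebraic and $\deg F_\Omega=\sum_{Q\in\Omega}\deg Q$. For $A\subseteq\mathbb{F}[x;\sigma,\delta]$, $Z_{\mathcal U_2}(A)=\{Q\in\mathcal U_2: Q\text{ right-divides every }F\in A\}$; $\Omega\subseteq\mathcal U_2$ is P-closed if $Z_{\mathcal U_2}(I(\Omega))=\Omega$. For a P-closed $\Omega'$, a P-basis is a P-independent set $\mathcal B$ with $\mathcal B\le\Omega'$ and $Z_{\mathcal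 U_2}(I(\mathcal B))=\Omega'$, where $\Psi\le\Omega'$ means every finite subset $\{Q_1,\dots,Q_n\}$ of $\Psi$ of size $n$ admits $\{P_1,\dots,P_n\}\subseteq\Omega'$ of size $n$ with $Q_i$ right-dividing $P_i$. For $C^{\sigma,\delta}(a)\subseteq\mathbb{F}$, a P-basis is a P-independent finite subset $\{a_1,\dots,a_m\}$ with $F_{\{a_1,\dots,a_m\}}=F_{C^{\sigma,\delta}(a)}$. The rank of a P-closed set is the degree of its minimal skew polynomial. *)

(* Defs.v *)
(* Skew polynomial ring F[x; sigma, delta] over a division ring F.
   Elements are represented by their left coefficient lists, i.e. by {poly F}
   (p = \sum_i p`_i x^i); the additive structure of {poly F} is the right one,
   and the skew multiplication is defined below from the rule
   x * a = sigma(a) x + delta(a). *)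
From HB Require Import structures.
From mathcomp Require Import all_boot all_order all_algebra.
Set Implicit Arguments. Unset Strict Implicit. Unset Printing Implicit Defensive.
Import GRing.Theory.
Local Open Scope ring_scope.

Section Skew.
Variable F : unitRingType.
Variable sigma : {rmorphism F -> F}.
Variable delta : F -> F.

(* left multiplication by x:  x * (\sum a_i x^i) = \sum (sigma a_i x^(i+1) + delta a_i x^i) *)
Definition skew_mulX (q : {poly F}) : {poly F} :=
  map_poly sigma q * 'X + map_poly delta q.

Definition skew_mul (p q : {poly F}) : {poly F} :=
  \sum_(i < size p) (p`_i)%:P * iter (nat_of_ord i) skew_mulX q.

Definition skew_exp (p : {poly F}) (n : nat) : {poly F} := iter n (skew_mul p) 1.

Definition deg (p : {poly F}) : nat := (size p).-1.

Definition rdvd (Q G : {poly F}) : Prop := exists H, G = skew_mul H Q.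

Definition sconj (a beta : F) : F :=
  sigma beta * a * beta^-1 + delta beta * beta^-1.

Definition conj_class (a : F) (c : F) : Prop :=
  exists2 beta : F, beta != 0 & c = sconj a beta.

(* P_b = (x - b_r) ... (x - b_1)  for b = [:: b_1; ...; b_r] *)
Definition Pseq (s : seq F) : {poly F} :=
  foldr (fun b acc => skew_mul acc ('X - b%:P)) 1 s.

Definition mult_seq (s : seq F) : Prop :=
  (0 < size s)%N /\ forall b, rdvd ('X - b%:P) (Pseq s) -> b = head 0 s.

Definition U2 (Q : {poly F}) : Prop := exists2 s, mult_seq s & Q = Pseq s.

Definition Ideal (Om : {poly F} -> Prop) (G : {poly F}) : Prop :=
  forall Q, Om Q -> rdvd Q G.

Definition algebraic (Om : {poly F} -> Prop) : Prop :=
  exists2 G, Ideal Om G & G != 0.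

Definition is_minpoly (Om : {poly F} -> Prop) (G : {poly F}) : Prop :=
  [/\ Ideal Om G, G \is monic &
      forall H, Ideal Om H -> H != 0 -> (size G <= size H)%N]
  \/ (G = 0 /\ forall H, Ideal Om H -> H = 0).

Definition linpolys (S : F -> Prop) (Q : {poly F}) : Prop :=
  exists2 b, S b & Q = 'X - b%:P.

Definition pindep (s : seq {poly F}) : Prop :=
  algebraic (fun Q => Q \in s) /\
  exists G, is_minpoly (fun Q => Q \in s) G /\
            deg G = (\sum_(Q <- undup s) deg Q)%N.

Definition Z_U2 (A : {poly F} -> Prop) (Q : {poly F}) : Prop :=
  U2 Q /\ forall G, A G -> rdvd Q G.

(* P-closed in U_2 (Omega is assumed to be a subset of U_2) *)
Definition pclosed (Om : {poly F} -> Prop) : Prop :=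
  forall Q, Z_U2 (Ideal Om) Q <-> Om Q.

Definition ple (Psi Om : {poly F} -> Prop) : Prop :=
  forall s : seq {poly F}, uniq s -> (forall Q, Q \in s -> Psi Q) ->
  exists t : seq {poly F},
    [/\ uniq t, size t = size s, (forall P, P \in t -> Om P) &
        forall i, (i < size s)%N -> rdvd (nth 0 s i) (nth 0 t i)].

Definition pbasis_of (B : seq {poly F}) (Om : {poly F} -> Prop) : Prop :=
  [/\ pindep B, ple (fun Q => Q \in B) Om &
      forall Q, Z_U2 (Ideal (fun Q => Q \in B)) Q <-> Om Q].

Definition pbasis_class (as_ : seq F) (a : F) : Prop :=
  [/\ uniq as_, (forall c, c \in as_ -> conj_class a c),
      pindep [seq 'X - c%:P | c <- as_] &
      forall G, is_minpoly (linpolys (fun c => c \in as_)) G <->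
                is_minpoly (linpolys (conj_class a)) G].

Definition Crank (a : F) (r : nat) (Q : {poly F}) : Prop :=
  exists s, [/\ mult_seq s, conj_class a (head 0 s), (size s <= r)%N & Q = Pseq s].

End Skew.

(* Main.v *)
Require Import Defs.
From HB Require Import structures.
From mathcomp Require Import all_boot all_order all_algebra.
From mathcomp Require Import zify.
From Stdlib Require Import Classical.
Import GRing.Theory.
Local Open Scope ring_scope.

(** Write [R] for the skew polynomial ring. By the product formula
    [(FG)(c) = F(c^e) e] for [e = G(c) <> 0], the minimal polynomial [P] of a
    conjugacy class [C] satisfies [PR <= RP], it is a product of linear factors,
    and its roots are exactly [C]; the minimal polynomials of distinct classes
    are coprime and commute.

    (1) goes by induction on the length of [b]. If [b_r] lies in [C], then
    [P P_b'] is a left multiple of [P_b]. Otherwise the minimal polynomial [V] of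
    the class of [b_r] is coprime to [P_b], whose only root is in [C], and
    [P^(r-1) = P^(r-1)(sV + tP_b)] lies in [R P_b] because [V] and [P] commute.

    For (2) and (3), add the [P_(a_i)] one by one to a least common left
    multiple [L]. Each has a single root, so it is either coprime to [L] or its
    root is already a root of [L]; and the roots of [L] are those of the least
    common left multiple of the [x - a_i] used so far. Counting degrees, any
    common multiple of multiplicity sequences of length [r] over a P-basis has
    degree at least [r deg P]. Starting instead from [L = P_s], where [P_s]
    divides [P^r], the same count gives [size s <= r]. *)

Section SkewTheory.
Set Implicit Arguments.
Unset Strict Implicit.

Variables (F : unitRingType) (sigma : {rmorphism F -> F}) (delta : F -> F).
Hypothesis Fdiv : forall x : F, x != 0 -> x \is a GRing.unit.
Hypothesis deltaD : forall x y : F, delta (x + y) = delta x + delta y.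
Hypothesis deltaM :
  forall x y : F, delta (x * y) = sigma x * delta y + delta x * y.

Implicit Types (p q s t : {poly F}) (b c d e : F).

Local Notation smulX := (skew_mulX sigma delta).
Local Notation "p ** q" := (skew_mul sigma delta p q)
  (at level 40, left associativity).
Local Notation "p ^** n" := (skew_exp sigma delta p n)
  (at level 30, right associativity).
Local Notation "q %r| p" := (rdvd sigma delta q p) (at level 70).
Local Notation lin c := ('X - c%:P).
Local Notation isroot p c := (rdvd sigma delta (lin c) p).
Local Notation conj := (sconj sigma delta).
Local Notation prod_lin := (Pseq sigma delta).

Lemma delta0 : delta 0 = 0.
Proof. by apply: (addrI (delta 0)); rewrite -deltaD !addr0. Qed.

Lemma delta1 : delta 1 = 0.
Proof.
apply: (addrI (delta 1)).
by rewrite -[in RHS](mul1r 1) deltaM rmorph1 mul1r mulr1 addr0.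
Qed.

Lemma mul_neq0 b c : b != 0 -> c != 0 -> b * c != 0.
Proof.
move=> b0 c0; apply: contraNneq c0 => bc0; apply/eqP.
by apply: (mulrI (Fdiv b0)); rewrite bc0 mulr0.
Qed.

Lemma inv_neq0 b : b != 0 -> b^-1 != 0.
Proof. by move=> b0; rewrite invr_eq0. Qed.

Lemma sigma_neq0 b : b != 0 -> sigma b != 0.
Proof.
move=> /Fdiv bU; apply: contraTneq (oner_neq0 F) => sb0.
by rewrite -(rmorph1 sigma) -(divrr bU) rmorphM sb0 mul0r eqxx.
Qed.

Lemma size_scale_div c p : c != 0 -> size (c *: p) = size p.
Proof. by move=> /Fdiv cU; apply: lreg_size; apply: mulrI. Qed.

(** * The ring structure *)

Lemma coef_smulX q i :
  (smulX q)`_i = sigma (if i is j.+1 then q`_j else 0) + delta q`_i.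
Proof.
rewrite /skew_mulX coefD coefMX !coef_map_id0 ?rmorph0 ?delta0 //.
by case: i => [|i] //=; rewrite ?rmorph0 // coef_map_id0 ?rmorph0.
Qed.

Lemma smulXD p q : smulX (p + q) = smulX p + smulX q.
Proof.
apply/polyP=> i; rewrite [RHS]coefD !coef_smulX coefD deltaD.
by case: i => [|i]; rewrite ?coefD ?rmorph0 ?rmorphD ?add0r // addrACA.
Qed.

Lemma smulX0 : smulX 0 = 0.
Proof. by apply: (addrI (smulX 0)); rewrite -smulXD !addr0. Qed.

Lemma smulXZ c q : smulX (c *: q) = sigma c *: smulX q + delta c *: q.
Proof.
apply/polyP=> i; rewrite [RHS]coefD !coefZ !coef_smulX coefZ deltaM mulrDr addrA.
by case: i => [|i]; rewrite ?coefZ ?rmorph0 ?mulr0 ?rmorphM.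
Qed.

(** With coefficients on the left, right multiplication by x only shifts them, so the ordinary
    product by ['X] is also the skew one and commutes with [smulX]. *)
Lemma smulX_shift p c :
  smulX (p * 'X + c%:P) = smulX p * 'X + (sigma c *: 'X + (delta c)%:P).
Proof.
apply/polyP=> i; rewrite coef_smulX [RHS]coefD [X in _ = _ + X]coefD.
rewrite coefZ coefX coefC [X in _ = X + _]coefMX.
rewrite [(p * 'X + _)`_i]coefD coefMX coefC coef_smulX.
case: i => [|[|i]] /=; rewrite ?coef_smulX ?(coefD, coefMX, coefC) /=.
- by rewrite rmorph0 mulr0 !add0r.
- by rewrite rmorph0 !add0r !addr0 mulr1 addrC.
- by rewrite mulr0 !addr0.
Qed.

(** The bound [n] is free so that factors of different sizes expand over one index range. *)
Lemma skew_mulE n p q : (size p <= n)%N ->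
  p ** q = \sum_(i < n) p`_i *: iter i smulX q.
Proof.
move=> le_pn; rewrite /skew_mul.
under eq_bigr do rewrite mul_polyC.
rewrite (big_ord_widen n (fun i => p`_i *: iter i smulX q)) // big_mkcond.
by apply: eq_bigr => i _; case: ltnP => // ?; rewrite nth_default ?scale0r.
Qed.

Lemma skew_mulDl p q s : (p + q) ** s = p ** s + q ** s.
Proof.
pose n := maxn (size p) (size q).
rewrite !(@skew_mulE n) ?leq_maxl ?leq_maxr ?(leq_trans (size_polyD _ _)) //.
by rewrite -big_split; apply: eq_bigr => i _; rewrite coefD scalerDl.
Qed.

Lemma skew_mulZl c p q : (c *: p) ** q = c *: (p ** q).
Proof.
rewrite (@skew_mulE (size p) (c *: p)) ?size_scale_leq // (@skew_mulE (size p)) //.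
by rewrite scaler_sumr; apply: eq_bigr => i _; rewrite coefZ scalerA.
Qed.

Lemma skew_mul0l q : 0 ** q = 0.
Proof. by rewrite /skew_mul size_poly0 big_ord0. Qed.

Lemma skew_mulCl c q : c%:P ** q = c *: q.
Proof.
by rewrite (@skew_mulE 1) ?size_polyC_leq1 // big_ord1 coefC.
Qed.

Lemma skew_mul1l q : 1 ** q = q.
Proof. by rewrite skew_mulCl scale1r. Qed.

Lemma skew_mul_shift p c q : (p * 'X + c%:P) ** q = p ** smulX q + c *: q.
Proof.
rewrite (@skew_mulE (size p).+1 (p * 'X + c%:P)); last first.
  rewrite (leq_trans (size_polyD _ _)) // geq_max.
  rewrite (leq_trans (size_polyMleq _ _)) ?size_polyX ?addn2 //=.
  by rewrite (leq_trans (size_polyC_leq1 _)).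
rewrite big_ord_recl /= coefD coefMX coefC add0r addrC; congr (_ + _).
rewrite (@skew_mulE (size p)) //; apply: eq_bigr => i _.
by rewrite coefD coefMX coefC /= addr0 -iterSr.
Qed.

Lemma skew_mulDr p q s : p ** (q + s) = p ** q + p ** s.
Proof.
elim/poly_ind: p q s => [|p c IHp] q s; first by rewrite !skew_mul0l addr0.
by rewrite !skew_mul_shift smulXD IHp scalerDr addrACA.
Qed.

Lemma skew_mul0r p : p ** 0 = 0.
Proof. by apply: (addrI (p ** 0)); rewrite -skew_mulDr !addr0. Qed.

Lemma skew_mulNl p q : (- p) ** q = - (p ** q).
Proof. by rewrite -scaleN1r skew_mulZl scaleN1r. Qed.

Lemma skew_mulNr p q : p ** (- q) = - (p ** q).
Proof. by apply/eqP; rewrite -addr_eq0 -skew_mulDr addNr skew_mul0r. Qed.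

Lemma skew_mulBl p q s : (p - q) ** s = p ** s - q ** s.
Proof. by rewrite skew_mulDl skew_mulNl. Qed.

Lemma skew_mulBr p q s : p ** (q - s) = p ** q - p ** s.
Proof. by rewrite skew_mulDr skew_mulNr. Qed.

Lemma skew_mulXl q : 'X ** q = smulX q.
Proof.
rewrite -['X](addr0 'X) -(mul1r 'X) -polyC0 skew_mul_shift.
by rewrite skew_mul1l scale0r addr0.
Qed.

(** This is associativity with first factor x; Horner induction then yields [skew_mulA]. *)
Lemma smulX_mul p q : smulX p ** q = smulX (p ** q).
Proof.
elim/poly_ind: p q => [|p c IHp] q; first by rewrite smulX0 skew_mul0l smulX0.
rewrite smulX_shift addrA -mul_polyC -mulrDl [LHS]skew_mul_shift.
by rewrite skew_mulDl IHp skew_mulCl skew_mul_shift smulXD smulXZ addrA.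
Qed.

Lemma skew_mulA p q s : p ** (q ** s) = p ** q ** s.
Proof.
elim/poly_ind: p q s => [|p c IHp] q s; first by rewrite !skew_mul0l.
by rewrite !skew_mul_shift skew_mulDl -IHp smulX_mul skew_mulZl.
Qed.

Lemma skew_mul1r p : p ** 1 = p.
Proof.
have smulXn i : iter i smulX 1 = 'X^i.
  elim: i => [|i IHi] /=; first by rewrite expr0.
  apply/polyP=> j; rewrite IHi coef_smulX !coefXn.
  have dn (b : bool) : delta b%:R = 0 by case: b; rewrite ?delta0 ?delta1.
  by rewrite dn addr0; case: j => [|j]; rewrite ?rmorph0 // coefXn rmorph_nat.
rewrite (@skew_mulE (size p)) // -[RHS]coefK poly_def.
by apply: eq_bigr => i _; rewrite smulXn.
Qed.

(** * Degrees and right division *)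

Lemma size_smulX q : q != 0 -> size (smulX q) = (size q).+1.
Proof.
move=> q0; rewrite /skew_mulX.
have sz : size (map_poly sigma q) = size q.
  by apply: size_map_poly_id0; rewrite sigma_neq0 ?lead_coef_eq0.
have sq0 : map_poly sigma q != 0 by rewrite -size_poly_eq0 sz size_poly_eq0.
rewrite size_polyDl size_mulX // sz // ltnS.
exact: size_poly.
Qed.

Lemma lead_smulX q : q != 0 -> lead_coef (smulX q) = sigma (lead_coef q).
Proof.
move=> q0; rewrite {1}/lead_coef size_smulX //= coef_smulX.
rewrite [q`_(size q)]nth_default // delta0 addr0 lead_coefE.
by rewrite -size_poly_gt0 in q0; case: (size q) q0.
Qed.

Lemma smulX_neq0 q : q != 0 -> smulX q != 0.
Proof. by move=> q0; rewrite -size_poly_gt0 size_smulX. Qed.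

(** In the Horner step with [p != 0], [p ** smulX q] is strictly larger than [c *: q] and so fixes
    the degree. *)
Lemma size_skew_mul p q : p != 0 -> q != 0 ->
  size (p ** q) = (size p + size q).-1.
Proof.
elim/poly_ind: p q => [|p c IHp] q; first by rewrite eqxx.
move=> pc0 q0; rewrite skew_mul_shift.
have [p0|p0] := eqVneq p 0.
  move: pc0; rewrite p0 mul0r add0r skew_mul0l add0r polyC_eq0 => c0.
  by rewrite size_scale_div // size_polyC c0.
have sp : (0 < size p)%N by rewrite size_poly_gt0.
have IH := IHp _ p0 (smulX_neq0 q0).
have spc : size (p * 'X + c%:P) = (size p).+1.
  by rewrite size_MXaddC (negPf p0).
rewrite size_polyDl IH ?size_smulX // ?spc; first by lia.
by apply: (leq_ltn_trans (size_scale_leq _ _)); lia.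
Qed.

Lemma monic_skew_mul p q : p \is monic -> q \is monic -> p ** q \is monic.
Proof.
elim/poly_ind: p q => [|p c IHp] q; first by rewrite monicE lead_coef0 eq_sym oner_eq0.
move=> pcM qM; rewrite skew_mul_shift; have q0 := monic_neq0 qM.
have [p0|p0] := eqVneq p 0.
  move: pcM; rewrite p0 mul0r add0r skew_mul0l add0r monicE lead_coefC.
  by move/eqP->; rewrite scale1r.
have sp : (0 < size p)%N by rewrite size_poly_gt0.
have pM : p \is monic.
  move: pcM; rewrite !monicE lead_coefDl ?lead_coefMX //.
  by rewrite size_mulX // (leq_ltn_trans (size_polyC_leq1 _)).
have XqM : smulX q \is monic.
  by rewrite monicE lead_smulX // (monicP qM) rmorph1.
rewrite monicE lead_coefDl; first by rewrite -monicE IHp.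
rewrite size_skew_mul ?smulX_neq0 // size_smulX //.
by apply: (leq_ltn_trans (size_scale_leq _ _)); lia.
Qed.

Lemma skew_mul_neq0 p q : p != 0 -> q != 0 -> p ** q != 0.
Proof.
move=> p0 q0; rewrite -size_poly_gt0 size_skew_mul //.
by move: p0 q0; rewrite -!size_poly_gt0; lia.
Qed.

Lemma skew_mulI p q s : s != 0 -> p ** s = q ** s -> p = q.
Proof.
move=> s0 eq_ps; apply/eqP; rewrite -subr_eq0; apply/negPn/negP => pq0.
by have := skew_mul_neq0 pq0 s0; rewrite skew_mulBl eq_ps subrr eqxx.
Qed.

Lemma skew_div p q : q != 0 ->
  exists h t, p = h ** q + t /\ (size t < size q)%N.
Proof.
move=> q0; have [n] := ubnP (size p); elim: n p => // n IHn p; rewrite ltnS => le_pn.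
have [lt_pq|le_qp] := ltnP (size p) (size q).
  by exists 0, p; rewrite skew_mul0l add0r.
have [k def_k] : exists k, size p = (k + size q)%N.
  by exists (size p - size q)%N; rewrite subnK.
(* Passing x across [q] twists its leading coefficient by [sigma], so the quotient [c] divides by
   that of [u]. *)
pose u := 'X^k ** q.
have Xk0 : 'X^k != 0 :> {poly F} by rewrite -size_poly_gt0 size_polyXn.
have su : size u = size p by rewrite size_skew_mul // size_polyXn def_k.
have p0 : p != 0 by rewrite -size_poly_gt0 (leq_trans _ le_qp) // size_poly_gt0.
have u0 : u != 0 by rewrite -size_poly_gt0 su size_poly_gt0.
pose c := lead_coef p * (lead_coef u)^-1.
have luU : lead_coef u \is a GRing.unit by rewrite Fdiv // lead_coef_eq0.
have lt_pcu : (size (p - c *: u)%R < size p)%N.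
  have le : (size (p - c *: u)%R <= size p)%N.
    rewrite (leq_trans (size_polyD _ _)) // size_polyN geq_max leqnn.
    by rewrite (leq_trans (size_scale_leq _ _)) ?su.
  rewrite ltn_neqAle le andbT; apply/eqP => eq_sz.
  have: lead_coef (p - c *: u) == 0.
    rewrite lead_coefE eq_sz coefB coefZ -{2}su -!lead_coefE /c.
    by rewrite mulrVK // subrr.
  by rewrite lead_coef_eq0 -size_poly_eq0 eq_sz size_poly_eq0 (negPf p0).
have [h [t [eq_h lt_t]]] := IHn _ (leq_trans lt_pcu le_pn).
exists (h + c *: 'X^k), t; split=> //.
by rewrite skew_mulDl skew_mulZl addrAC -eq_h subrK.
Qed.

Lemma rdvd_refl p : p %r| p.
Proof. by exists 1; rewrite skew_mul1l. Qed.

Lemma rdvd0 p : p %r| 0.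
Proof. by exists 0; rewrite skew_mul0l. Qed.

Lemma rdvd_mull p q s : p %r| q -> p %r| s ** q.
Proof. by case=> h ->; exists (s ** h); rewrite skew_mulA. Qed.

Lemma rdvd_trans p q s : p %r| q -> q %r| s -> p %r| s.
Proof. by move=> pq [h ->]; apply: rdvd_mull. Qed.

Lemma rdvd_mull_self p q : p %r| q ** p.
Proof. by exists q. Qed.

Lemma rdvdD p q s : p %r| q -> p %r| s -> p %r| q + s.
Proof. by case=> h -> [k ->]; exists (h + k); rewrite skew_mulDl. Qed.

Lemma rdvdB p q s : p %r| q -> p %r| s -> p %r| q - s.
Proof. by case=> h -> [k ->]; exists (h - k); rewrite skew_mulBl. Qed.

Lemma rdvd_mulr p q s : p %r| q -> p ** s %r| q ** s.
Proof. by case=> h ->; exists h; rewrite skew_mulA. Qed.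

Lemma rdvd_size p q : p %r| q -> q != 0 -> (size p <= size q)%N.
Proof.
case=> h -> hp0; have h0 : h != 0 by apply: contraNneq hp0 => ->; rewrite skew_mul0l.
have p0 : p != 0 by apply: contraNneq hp0 => ->; rewrite skew_mul0r.
by rewrite size_skew_mul //; move: h0; rewrite -size_poly_gt0; lia.
Qed.

Lemma rdvd_size_const p q : p %r| q -> q != 0 -> (size q <= size p)%N ->
  exists2 c, c != 0 & q = c *: p.
Proof.
case=> h def_q q0 le_qp.
have p0 : p != 0 by apply: contraNneq q0 => p0; rewrite def_q p0 skew_mul0r.
have h0 : h != 0 by apply: contraNneq q0 => h0; rewrite def_q h0 skew_mul0l.
have /size1_polyC ch : (size h <= 1)%N.
  move: le_qp; rewrite def_q size_skew_mul //.
  by move: p0; rewrite -size_poly_gt0; lia.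
exists h`_0; first by apply: contraNneq h0 => h00; rewrite ch h00.
by rewrite -skew_mulCl -ch.
Qed.

Lemma rdvd_size_sym p q : p %r| q -> q != 0 -> (size q <= size p)%N -> q %r| p.
Proof.
move=> pq q0 le_qp; have [c c0 ->] := rdvd_size_const pq q0 le_qp.
by exists (c^-1)%:P; rewrite skew_mulCl scalerA mulVr ?Fdiv // scale1r.
Qed.

Lemma rdvd_monic_eq p q : p \is monic -> q \is monic -> p %r| q ->
  (size q <= size p)%N -> q = p.
Proof.
move=> pM qM pq le_qp; have [c c0 def_q] := rdvd_size_const pq (monic_neq0 qM) le_qp.
move: qM; rewrite def_q monicE lead_coefE size_scale_div // coefZ -lead_coefE.
by rewrite (monicP pM) mulr1 => /eqP->; rewrite scale1r.
Qed.

(** * Greatest common right divisors and least common left multiples *)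

Lemma gcd_lcm p q : p != 0 -> q != 0 -> exists D M,
  [/\ exists u v, D = u ** p + v ** q,
      D %r| p /\ D %r| q,
      p %r| M /\ q %r| M,
      forall N, p %r| N -> q %r| N -> M %r| N &
      (size M + size D = size p + size q)%N].
Proof.
have [n] := ubnP (size q); elim: n p q => // n IHn p q; rewrite ltnS => le_qn p0 q0.
have [h [t [def_p lt_tq]]] := skew_div p q0.
have [t0|t0] := eqVneq t 0.
  have qp : q %r| p by exists h; rewrite def_p t0 addr0.
  exists q, p; split=> //; last by split=> //; apply: rdvd_refl.
    by exists 0, 1; rewrite skew_mul0l skew_mul1l add0r.
  by split=> //; apply: rdvd_refl.
have def_t : t = p - h ** q by rewrite def_p addrC addKr.
have [D [M [[u [v def_D]] [Dq Dt] [[w qM] [s tM]] minM sizeM]]] :=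
  IHn q t (leq_trans lt_tq le_qn) q0 t0.
have D0 : (0 < size D)%N.
  rewrite size_poly_gt0; apply: contraNneq q0 => D0.
  by case: Dq => k ->; rewrite D0 skew_mul0r.
have M0 : M != 0.
  rewrite -size_poly_gt0; have := rdvd_size Dt t0.
  by move: q0; rewrite -size_poly_gt0; lia.
have s0 : s != 0 by apply: contraNneq M0 => s0; rewrite tM s0 skew_mul0l.
exists D, (s ** p); split.
- exists v, (u - v ** h).
  by rewrite def_D def_t skew_mulBr skew_mulBl !skew_mulA addrCA.
- by split=> //; rewrite def_p; apply: rdvdD => //; apply: rdvd_mull.
- split; first by exists s.
  by exists (s ** h + w); rewrite def_p skew_mulDr skew_mulDl -tM -qM skew_mulA.
- move=> N [x xN] [y yN].
  have [z]: M %r| x ** t.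
    apply: minM; last by exists x.
    by exists (y - x ** h); rewrite def_t skew_mulBr skew_mulBl -xN -yN skew_mulA.
  rewrite tM skew_mulA => /(skew_mulI t0) xE.
  by exists z; rewrite xN xE skew_mulA.
- move: sizeM; rewrite tM !size_skew_mul //.
  by move: s0 t0 p0; rewrite -!size_poly_gt0; lia.
Qed.

(** The greatest common right divisor is a nonzero constant; dividing by it turns the Bezout
    relation into one for [1]. *)
Lemma coprime_lcm p q : p != 0 -> q != 0 ->
  (forall D, D %r| p -> D %r| q -> (size D <= 1)%N) ->
  exists u v M, [/\ u ** p + v ** q = 1, p %r| M, q %r| M,
    forall N, p %r| N -> q %r| N -> M %r| N & size M = (size p + size q).-1].
Proof.
move=> p0 q0 cop; have [D [M [[u [v def_D]] [Dp Dq] [pM qM] minM sizeM]]] := gcd_lcm p0 q0.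
have /size1_polyC D1 := cop D Dp Dq.
have d0 : D`_0 != 0.
  by apply: contraNneq p0 => d0; case: Dp => h ->; rewrite D1 d0 skew_mul0r.
exists ((D`_0)^-1 *: u), ((D`_0)^-1 *: v), M; split=> //.
  rewrite !skew_mulZl -scalerDr -def_D {2}D1 -mul_polyC -polyCM mulVr //.
  exact: Fdiv.
by move: sizeM; rewrite D1 size_polyC d0; lia.
Qed.

Lemma skew_expS p n : p ^** n.+1 = p ** p ^** n.
Proof. by []. Qed.

Lemma monic_skew_exp p n : p \is monic -> p ^** n \is monic.
Proof.
move=> pM; elim: n => [|n IHn]; first exact: monic1.
exact: monic_skew_mul.
Qed.

Lemma size_skew_exp p n : p \is monic -> size (p ^** n) = (n * (size p).-1).+1.
Proof.
move=> pM; elim: n => [|n IHn]; first by rewrite mul0n size_poly1.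
have p0 := monic_neq0 pM.
rewrite skew_expS size_skew_mul ?(monic_neq0 (monic_skew_exp n pM)) // IHn.
by move: p0; rewrite -size_poly_gt0; lia.
Qed.

Lemma rdvd_skew_exp p m n : (m <= n)%N -> p ^** m %r| p ^** n.
Proof.
move/subnK<-; elim: (n - m)%N => [|k IHk]; first exact: rdvd_refl.
exact: rdvd_mull.
Qed.

(** * Linear right divisors and conjugation *)

Lemma lin_neq0 c : lin c != 0.
Proof. exact: monic_neq0 (monicXsubC c). Qed.

Lemma smulXC c : smulX c%:P = sigma c *: 'X + (delta c)%:P.
Proof. by rewrite -[c%:P]add0r -(mul0r 'X) smulX_shift smulX0 mul0r add0r. Qed.

(** Conjugation is the twist that lets a nonzero constant cross a linear factor; the product formula
    rests on it. *)
Lemma lin_conj_mul c e : e != 0 -> lin (conj c e) ** e%:P = sigma e *: lin c.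
Proof.
move=> e0; rewrite skew_mulBl skew_mulXl smulXC skew_mulCl -[X in _ - X]mul_polyC.
rewrite -polyCM mulrDl !mulrVK ?Fdiv // polyCD opprD addrACA subrr addr0.
by rewrite scalerBr -mul_polyC polyCM mul_polyC mul_polyC.
Qed.

Lemma lin_div p c : exists h e, p = h ** lin c + e%:P.
Proof.
have [h [t [-> ]]] := skew_div p (lin_neq0 c).
rewrite size_XsubC ltnS => /size1_polyC->.
by exists h, t`_0.
Qed.

Lemma isroot_rem h c e : isroot (h ** lin c + e%:P) c <-> e = 0.
Proof.
split=> [rt|->]; last by rewrite addr0; exists h.
apply/eqP/negPn/negP => e0.
have := rdvdB rt (rdvd_mull h (rdvd_refl (lin c))).
rewrite addrAC subrr add0r => /rdvd_size; rewrite polyC_eq0 size_polyC size_XsubC.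
by rewrite e0 => /(_ isT).
Qed.

(** Product formula: if [q] has remainder [e] at [c] and [p] has remainder [f] at [conj c e], then
    [p ** q] has remainder [f * e]. One [e] serves every [p], so left factors can be compared. *)
Lemma isroot_mul q c : isroot q c \/
  exists2 e, e != 0 & forall p, isroot (p ** q) c <-> isroot p (conj c e).
Proof.
have [k [e def_q]] := lin_div q c.
have [e0|e0] := eqVneq e 0; first by left; exists k; rewrite def_q e0 addr0.
right; exists e => // p; have [h [f def_p]] := lin_div p (conj c e).
have -> : p ** q = (p ** k + h ** (sigma e)%:P) ** lin c + (f * e)%:P.
  rewrite def_q skew_mulDr skew_mulA skew_mulDl -addrA; congr (_ + _).
  rewrite {1}def_p skew_mulDl -!skew_mulA lin_conj_mul // !skew_mulCl.
  by rewrite polyCM mul_polyC.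
rewrite isroot_rem {1}def_p isroot_rem; split=> [fe0|->]; last by rewrite mul0r.
by apply: (mulIr (Fdiv e0)); rewrite mul0r.
Qed.

Lemma isroot_mull p q c : isroot q c -> isroot (p ** q) c.
Proof. exact: rdvd_mull. Qed.

Lemma isroot_lin b c : isroot (lin b) c -> b = c.
Proof.
rewrite -[lin b](_ : 1 ** lin c + (c - b)%:P = _) ?isroot_rem.
  by move/eqP; rewrite subr_eq0 => /eqP.
by rewrite skew_mul1l polyCB addrA subrK.
Qed.

Lemma conj_conj c b e : b != 0 -> e != 0 -> conj (conj c b) e = conj c (e * b).
Proof.
move=> b0 e0; rewrite /sconj invrM ?Fdiv // rmorphM deltaM.
by rewrite !mulrDl mulrDr !mulrA mulrDl mulrK ?Fdiv // addrA.
Qed.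

Lemma conj1 c : conj c 1 = c.
Proof. by rewrite /sconj rmorph1 delta1 invr1 mul1r mulr1 mul0r addr0. Qed.

Lemma conjK c e : e != 0 -> conj (conj c e) e^-1 = c.
Proof. by move=> e0; rewrite conj_conj ?inv_neq0 // mulVr ?Fdiv // conj1. Qed.

(** * Conjugacy classes and products of linear factors *)

Local Notation cls := (conj_class sigma delta).

Lemma cls_refl a : cls a a.
Proof. by exists 1; rewrite ?oner_neq0 // conj1. Qed.

Lemma cls_conj a c e : e != 0 -> cls a (conj c e) <-> cls a c.
Proof.
suff cls_conj1 c' e' : e' != 0 -> cls a c' -> cls a (conj c' e').
  move=> e0; split; last exact: cls_conj1.
  by move/(cls_conj1 _ _ (inv_neq0 e0)); rewrite conjK.
move=> e0 [b b0 ->]; rewrite conj_conj //.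
by exists (e' * b) => //; apply: mul_neq0.
Qed.

Lemma cls_meet a d c : cls a c -> cls d c -> cls a d.
Proof. by move=> ac [e e0 def_c]; move: ac; rewrite def_c cls_conj. Qed.

(** Inductions on the last entry strip the leftmost factor, so initial segments remain right
    divisors. *)
Lemma Pseq_rcons w b : prod_lin (rcons w b) = lin b ** prod_lin w.
Proof.
elim: w => [|c w IHw] /=; first by rewrite skew_mul1l skew_mul1r.
by rewrite IHw skew_mulA.
Qed.

Lemma monic_Pseq w : prod_lin w \is monic.
Proof.
elim: w => [|c w IHw] /=; first exact: monic1.
by apply: monic_skew_mul => //; apply: monicXsubC.
Qed.

Lemma Pseq_neq0 w : prod_lin w != 0.
Proof. exact: monic_neq0 (monic_Pseq w). Qed.

Lemma size_Pseq w : size (prod_lin w) = (size w).+1.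
Proof.
elim: w => [|c w IHw] /=; first by rewrite size_poly1.
by rewrite size_skew_mul ?Pseq_neq0 ?lin_neq0 // IHw size_XsubC addnC.
Qed.

Lemma isroot_Pseq_head w : (0 < size w)%N -> isroot (prod_lin w) (head 0 w).
Proof. by case: w => //= c w _; exists (prod_lin w). Qed.

Lemma not_isroot1 c : ~ isroot 1 c.
Proof.
move/rdvd_size; rewrite size_poly1 size_XsubC oner_neq0.
by move/(_ isT).
Qed.

Lemma isroot_mul_cls a p q c : (forall y, isroot p y -> cls a y) ->
  (forall y, isroot q y -> cls a y) -> isroot (p ** q) c -> cls a c.
Proof.
move=> pa qa; have [/qa //|[e e0 pq]] := isroot_mul q c.
by move/pq/pa; rewrite cls_conj.
Qed.

Lemma isroot_Pseq_cls a w c : (forall y, y \in w -> cls a y) ->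
  isroot (prod_lin w) c -> cls a c.
Proof.
elim: w c => [|b w IHw] c aw /=; first by move/not_isroot1.
apply: isroot_mul_cls => y; last by move/isroot_lin<-; apply: aw; rewrite mem_head.
by apply: IHw => z zw; apply: aw; rewrite in_cons zw orbT.
Qed.

Lemma isroot_size2 p : size p = 2%N -> exists c, isroot p c.
Proof.
move=> sp; have p1 : p`_1 != 0.
  by have := lead_coef_eq0 p; rewrite lead_coefE sp -size_poly_eq0 sp => ->.
exists (- ((p`_1)^-1 * p`_0)), (p`_1)%:P; rewrite skew_mulCl.
apply/polyP=> i; rewrite coefZ coefB coefX coefC.
case: i => [|[|i]] /=; rewrite ?subr0 ?mulr1 ?mulr0 ?opprK //.
  by rewrite add0r mulrA divrr ?Fdiv // mul1r.
by rewrite nth_default ?sp.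
Qed.

(* A nonconstant [g] coprime to [Q] has degree at most 1 if it right divides
   [(x - b) Q], because their least common left multiple does. *)
Lemma Pseq_rdvd_root w g : g %r| prod_lin w -> (1 < size g)%N ->
  exists c, isroot g c.
Proof.
elim/last_ind: w g => [|w b IHw] g gw g1.
  by have := rdvd_size gw (Pseq_neq0 [::]); rewrite size_Pseq leqNgt g1.
have g0 : g != 0 by rewrite -size_poly_gt0 ltnW.
have [D [M [_ [Dg Dw] [gM wM] minM sizeM]]] := gcd_lcm g0 (Pseq_neq0 w).
have [D1|/(IHw D Dw)[c Dc]] := leqP (size D) 1; last by exists c; apply: rdvd_trans Dg.
apply: isroot_size2; apply/eqP; rewrite eqn_leq g1 andbT.
have Mw : M %r| prod_lin (rcons w b).
  by apply: minM => //; rewrite Pseq_rcons; exists (lin b).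
have := rdvd_size Mw (Pseq_neq0 _); move: sizeM; rewrite !size_Pseq size_rcons.
by lia.
Qed.

Lemma linpolysP (S : F -> Prop) p :
  Ideal sigma delta (linpolys S) p <-> forall c, S c -> isroot p c.
Proof.
split=> [Ip c Sc|rp Q [c Sc ->]]; last exact: rp.
by apply: Ip; exists c.
Qed.

(** Makes [prod_lin w] the minimal polynomial of the class, with an explicit factorization over the
    class; minimality is put as divisibility. *)
Definition splits_class a (w : seq F) :=
  [/\ forall y, y \in w -> cls a y,
      forall c, cls a c -> isroot (prod_lin w) c &
      forall p, (forall c, cls a c -> isroot p c) -> prod_lin w %r| p].

(* Adjoin roots greedily: if [d] is not a root of [W], the least common left
   multiple of [W] and [x - d] is [(x - d^e) W] for some conjugate of [d]. *)
Lemma minpoly_split a : algebraic sigma delta (linpolys (cls a)) ->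
  exists w, splits_class a w.
Proof.
case=> G /linpolysP aG G0.
(* Each product built right divides [G], so the gap [size G - size w] shrinks with every adjoined
   root. *)
suff gen n (w : seq F) : (size G - size w < n)%N -> (forall y, y \in w -> cls a y) ->
    (forall p, (forall c, cls a c -> isroot p c) -> prod_lin w %r| p) ->
    exists w, splits_class a w.
  apply: (gen (size G).+1 [::]) => //= [|p _]; first by rewrite ltnS leq_subr.
  by exists p; rewrite skew_mul1r.
elim: n w => // n IHn w lt_n aw wI.
have [|nall] := classic (forall c, cls a c -> isroot (prod_lin w) c).
  by exists w; split.
have [d nd] := not_all_ex_not _ _ nall.
have [ad nwd] := imply_to_and _ _ nd.
have [//|[e e0 rt]] := isroot_mul (prod_lin w) d.
have w'I p : (forall c, cls a c -> isroot p c) ->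
    prod_lin (rcons w (conj d e)) %r| p.
  move=> ap; have [h def_p] := wI p ap; rewrite Pseq_rcons def_p.
  by apply: rdvd_mulr; rewrite -rt -def_p; apply: ap.
apply: (IHn _ _ _ w'I) => [|y].
  have := rdvd_size (w'I G aG) G0; rewrite size_Pseq size_rcons.
  by move: lt_n; lia.
by rewrite mem_rcons in_cons => /predU1P[->|/aw//]; rewrite cls_conj.
Qed.

(** * Minimal polynomials of conjugacy classes *)

Lemma splits_class_root a w c : splits_class a w -> isroot (prod_lin w) c <-> cls a c.
Proof. by case=> aw rw _; split=> [/(isroot_Pseq_cls aw)|/rw]. Qed.

Lemma isroot_splits_exp a w n c : splits_class a w ->
  isroot (prod_lin w ^** n) c -> cls a c.
Proof.
move=> aw; elim: n c => [|n IHn] c; first by move/not_isroot1.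
by apply: isroot_mul_cls => // y; rewrite (splits_class_root _ aw).
Qed.

(* The left ideal generated by the minimal polynomial of a class is two-sided. *)
Lemma splits_class_mull a w p : splits_class a w ->
  exists q, prod_lin w ** p = q ** prod_lin w.
Proof.
case=> _ rw wI; apply: wI => c ac.
have [rp|[e e0 ->]] := isroot_mul p c; first exact: isroot_mull.
by apply: rw; rewrite cls_conj.
Qed.

Lemma splits_class_exp_mull a w n p : splits_class a w ->
  exists q, prod_lin w ^** n ** p = q ** prod_lin w ^** n.
Proof.
move=> aw; elim: n => [|n [q def_q]].
  by exists p; rewrite skew_mul1l skew_mul1r.
have [t def_t] := splits_class_mull q aw.
by exists t; rewrite skew_expS -skew_mulA def_q !skew_mulA def_t.
Qed.

(* Both products are the least common left multiple of the two factors. *)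
Lemma splits_class_comm a d w v : splits_class a w -> splits_class d v -> ~ cls a d ->
  prod_lin w ** prod_lin v = prod_lin v ** prod_lin w.
Proof.
move=> aw dv nad.
have cop D : D %r| prod_lin w -> D %r| prod_lin v -> (size D <= 1)%N.
  move=> Dw Dv; case: leqP => // /(Pseq_rdvd_root Dw)[c Dc]; case: nad.
  apply: (@cls_meet _ _ c).
    by rewrite -(splits_class_root _ aw); apply: rdvd_trans Dw.
  by rewrite -(splits_class_root _ dv); apply: rdvd_trans Dv.
have [_ [_ [M [_ _ _ minM sizeM]]]] := coprime_lcm (Pseq_neq0 w) (Pseq_neq0 v) cop.
have [x wx] := splits_class_mull (prod_lin v) aw.
have [y vy] := splits_class_mull (prod_lin w) dv.
have Mwv : M %r| prod_lin w ** prod_lin v by apply: minM; [exists x | exact: rdvd_mull_self].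
have Mvw : M %r| prod_lin v ** prod_lin w by apply: minM; [exact: rdvd_mull_self | exists y].
have wvM : prod_lin w ** prod_lin v \is monic by rewrite monic_skew_mul ?monic_Pseq.
have vwM : prod_lin v ** prod_lin w \is monic by rewrite monic_skew_mul ?monic_Pseq.
apply: rdvd_monic_eq => //; last by rewrite !size_skew_mul ?Pseq_neq0 // addnC.
apply: rdvd_trans Mwv; apply: rdvd_size_sym => //; first exact: monic_neq0.
by rewrite sizeM size_skew_mul ?Pseq_neq0 // addnC.
Qed.

Lemma splits_class_exp_comm a d w v n : splits_class a w -> splits_class d v ->
  ~ cls a d -> prod_lin w ^** n ** prod_lin v = prod_lin v ** prod_lin w ^** n.
Proof.
move=> aw dv nad; elim: n => [|n IHn]; first by rewrite skew_mul1l skew_mul1r.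
by rewrite skew_expS -skew_mulA IHn !skew_mulA (splits_class_comm aw dv nad).
Qed.

(** * Multiplicity sequences *)

(** The root [h] is a separate parameter, so that the induction can start from the empty sequence,
    which has no root. *)
Lemma Pseq_rdvd_exp a w (b : seq F) h :
    (forall c, algebraic sigma delta (linpolys (cls c))) ->
    splits_class a w -> cls a h -> (forall c, isroot (prod_lin b) c -> c = h) ->
  prod_lin b %r| prod_lin w ^** size b.
Proof.
move=> all_alg aw ah; elim/last_ind: b => [|b d IHb] bh; first exact: rdvd_refl.
rewrite size_rcons; have [|A def_A] := IHb.
  by move=> c bc; apply: bh; rewrite Pseq_rcons; apply: isroot_mull.
(* Let P be [prod_lin w]. If [d] is in the class, P A P_b = A' P P_b, and P is a left multiple of
   [lin d]. *)
have [[U def_U]|nwd] := classic (isroot (prod_lin w) d).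
  have [A' AA'] := splits_class_mull A aw.
  exists (A' ** U); rewrite skew_expS def_A skew_mulA AA' def_U.
  by rewrite Pseq_rcons !skew_mulA.
have nad : ~ cls a d by rewrite -splits_class_root; eauto.
have [v dv] := minpoly_split (all_alg d).
have [V def_V] : isroot (prod_lin v) d by rewrite (splits_class_root _ dv); apply: cls_refl.
have [|s [t [_ [st1 _ _ _ _]]]] := coprime_lcm (Pseq_neq0 v) (Pseq_neq0 (rcons b d)).
  move=> D Dv Db; case: leqP => // /(Pseq_rdvd_root Dv)[c Dc]; case: nad.
  have ch : c = h by apply: bh; apply: rdvd_trans Db.
  apply: cls_meet ah _; rewrite -(splits_class_root _ dv) -ch.
  exact: rdvd_trans Dv.
suff: prod_lin (rcons b d) %r| prod_lin w ^** size b by move/rdvd_trans; apply; exact: rdvd_mull_self.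
rewrite -[prod_lin w ^** _]skew_mul1r -st1 skew_mulDr; apply: rdvdD; last first.
  by rewrite skew_mulA; exact: rdvd_mull_self.
(* With n = [size b] and V for [prod_lin v]: P^n s V = s' P^n V = s' V P^n = s' V A P_b = s' A' V
   P_b, and V is a left multiple of [lin d]. *)
have [s' ws] := splits_class_exp_mull (size b) s aw.
rewrite skew_mulA ws -skew_mulA (splits_class_exp_comm _ aw dv nad) def_A.
have [A' vA] := splits_class_mull A dv.
rewrite [prod_lin v ** _]skew_mulA vA def_V Pseq_rcons.
by exists (s' ** (A' ** V)); rewrite !skew_mulA.
Qed.

Local Notation mseq := (mult_seq sigma delta).

Lemma mult_seq_rdvd_exp a w (b : seq F) n :
    (forall c, algebraic sigma delta (linpolys (cls c))) ->
    splits_class a w -> mseq b -> cls a (head 0 b) -> (size b <= n)%N ->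
  prod_lin b %r| prod_lin w ^** n.
Proof.
move=> all_alg aw [_ bh] ab le_bn.
exact: rdvd_trans (Pseq_rdvd_exp all_alg aw ab bh) (rdvd_skew_exp _ le_bn).
Qed.

(* If no [b] extended [s], then every [(x - b) P_s] with [b] in the class would
   divide the least common left multiple of [P_s] and [P], hence so would
   [P P_s], whose degree is too large. *)
Lemma mult_seq_extend a w (s : seq F) : splits_class a w -> mseq s -> cls a (head 0 s) ->
  exists b, mseq (rcons s b).
Proof.
move=> aw [s0 sh] as_; apply: NNPP => next.
have [D [M [[u [v def_D]] [Dw Ds] [wM [W def_M]] minM sizeM]]] :=
  gcd_lcm (Pseq_neq0 w) (Pseq_neq0 s).
have D1 : (1 < size D)%N.
  have D0 : D != 0.
    apply: contraNneq (Pseq_neq0 w) => D0.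
    by case: Dw => h ->; rewrite D0 skew_mul0r.
  suff /rdvd_size/(_ D0) : isroot D (head 0 s) by rewrite size_XsubC.
  rewrite def_D; apply: rdvdD; apply: rdvd_mull; last exact: isroot_Pseq_head.
  by rewrite (splits_class_root _ aw).
(* Here [W] is the cofactor in [M = W ** prod_lin s]. A second root [c] of the extension by [b]
   forces [b = conj c e]; then [c] is in the class, so [M] vanishes at [c] and [W] at [b]. *)
have wW : prod_lin w %r| W.
  case: aw => _ rw; apply=> b ab; apply: NNPP => nWb; apply: next; exists b.
  split=> [|c]; first by rewrite size_rcons.
  have -> : head 0 (rcons s b) = head 0 s by case: (s) s0.
  have [/sh//|[e e0 eqr]] := isroot_mul (prod_lin s) c.
  rewrite Pseq_rcons eqr => /isroot_lin def_b.
  case: nWb; rewrite def_b -eqr -def_M; apply: rdvd_trans wM.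
  by apply: rw; rewrite -(cls_conj _ _ e0) -def_b.
have M0 : M != 0.
  rewrite -size_poly_gt0; have := rdvd_size Dw (Pseq_neq0 w).
  by move: sizeM; rewrite !size_Pseq; lia.
have := rdvd_size (rdvd_mulr (prod_lin s) wW); rewrite -def_M => /(_ M0).
by move: sizeM; rewrite size_skew_mul ?Pseq_neq0 // !size_Pseq; lia.
Qed.

Lemma mult_seq_exists a w h n : splits_class a w -> cls a h ->
  exists b : seq F, [/\ mseq b, size b = n.+1 & head 0 b = h].
Proof.
move=> aw ah; elim: n => [|n [b [bm sb hb]]].
  by exists [:: h]; split=> //; split=> //= c; rewrite skew_mul1l => /isroot_lin.
have [|c bcm] := mult_seq_extend aw bm; first by rewrite hb.
by exists (rcons b c); split; rewrite ?size_rcons ?sb //; case: (b) sb hb.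
Qed.

(* Write [N = N u L + N v Q]: since [L v Q = L - L u L] is a common multiple of
   [L] and [Q], it vanishes at [c]; by the product formula so does [L' v Q], of
   which [N v Q] is a multiple. The other summand is symmetric. *)
Lemma isroot_lcm_coprime L Q L' Q' M u v c :
    u ** L + v ** Q = 1 ->
    (forall N, L %r| N -> Q %r| N -> M %r| N) ->
    (forall y, isroot L y -> isroot L' y) -> (forall y, isroot Q y -> isroot Q' y) ->
    isroot M c -> forall N, L' %r| N -> Q' %r| N -> isroot N c.
Proof.
move=> uv1 minM LL' QQ' Mc N L'N Q'N.
have lift A A' B : (forall y, isroot A y -> isroot A' y) ->
    isroot (A ** B) c -> isroot (A' ** B) c.
  move=> AA'; have [Bc|[e e0 eqr]] := isroot_mul B c; last by rewrite !eqr; apply: AA'.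
  by move=> _; apply: isroot_mull.
have uLc : u ** L = 1 - v ** Q by rewrite -uv1 addrK.
have vQc : v ** Q = 1 - u ** L by rewrite -uv1 addrC addKr.
rewrite -[N]skew_mul1r -uv1 skew_mulDr.
apply: rdvdD.
  case: Q'N => x ->; rewrite -skew_mulA; apply: isroot_mull; apply: (lift Q) => //.
  apply: rdvd_trans Mc _; apply: minM; first by rewrite skew_mulA; apply: rdvd_mull_self.
  rewrite uLc skew_mulBr skew_mul1r skew_mulA.
  by apply: rdvdB; [apply: rdvd_refl | apply: rdvd_mull_self].
case: L'N => x ->; rewrite -skew_mulA; apply: isroot_mull; apply: (lift L) => //.
apply: rdvd_trans Mc _; apply: minM; last by rewrite skew_mulA; apply: rdvd_mull_self.
rewrite vQc skew_mulBr skew_mul1r skew_mulA.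
by apply: rdvdB; [apply: rdvd_refl | apply: rdvd_mull_self].
Qed.

(* [L] is the least common left multiple of [L0] and of the [P_s] that are
   processed, a point being skipped when it is already a root; since each new
   [P_s] has a single root, it is coprime to the multiple obtained before it. *)
Lemma mult_seq_greedy H r (l : seq F) L0 S0 :
    L0 != 0 -> S0 != 0 -> L0 %r| H -> (forall y, isroot L0 y -> isroot S0 y) ->
    (forall c, c \in l -> exists s : seq F,
       [/\ mseq s, size s = r, head 0 s = c & prod_lin s %r| H]) ->
  exists L S, [/\ L %r| H, S != 0, S0 %r| S, forall c, c \in l -> isroot S c &
    (size L0 + r * size S <= size L + r * size S0)%N].
Proof.
elim: l L0 S0 => [|c l IHl] L0 S0 L00 S00 L0H rL0 lH.
  by exists L0, S0; split=> //; apply: rdvd_refl.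
have lH' y : y \in l -> exists s : seq F,
    [/\ mseq s, size s = r, head 0 s = y & prod_lin s %r| H].
  by move=> ly; apply: lH; rewrite in_cons ly orbT.
have [L0c|nL0c] := classic (isroot L0 c).
  have [L [S [LH S1 S0S rS le]]] := IHl L0 S0 L00 S00 L0H rL0 lH'.
  exists L, S; split=> // y /predU1P[->|/rS//].
  by apply: rdvd_trans S0S; apply: rL0.
have [s [[s0 sh] sr sc sH]] := lH c (mem_head _ _).
have [|u [v [L1 [uv1 L0L1 sL1 minL1 sizeL1]]]] := coprime_lcm L00 (Pseq_neq0 s).
  move=> D DL0 Ds; case: leqP => // /(Pseq_rdvd_root Ds)[y Dy]; case: nL0c.
  have <- : y = c by rewrite -sc; apply: sh; apply: rdvd_trans Ds.
  exact: rdvd_trans DL0.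
have [D [S1 [_ [DS0 _] [S0S1 cS1] minS1 sizeS1]]] := gcd_lcm S00 (lin_neq0 c).
have D0 : (0 < size D)%N.
  rewrite size_poly_gt0; apply: contraNneq S00 => D0.
  by case: DS0 => k ->; rewrite D0 skew_mul0r.
have S10 : S1 != 0.
  rewrite -size_poly_gt0; have := rdvd_size DS0 S00.
  by move: sizeS1; rewrite size_XsubC; lia.
have L10 : L1 != 0.
  by rewrite -size_poly_gt0 sizeL1 size_Pseq; move: L00; rewrite -size_poly_gt0; lia.
have rL1 y : isroot L1 y -> isroot S1 y.
  move=> L1y; apply: (isroot_lcm_coprime uv1 minL1 rL0 _ L1y S0S1 cS1).
  by move=> z /sh ->; rewrite sc; apply: rdvd_refl.
have [L [S [LH S_0 S1S rS le]]] := IHl L1 S1 L10 S10 (minL1 H L0H sH) rL1 lH'.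
exists L, S; split=> //; first exact: rdvd_trans S1S.
  by move=> y /predU1P[->|/rS//]; apply: rdvd_trans S1S.
(* The size of [L1] exceeds that of [L0] by exactly [r], while [S1] exceeds [S0] by at most one. *)
move: sizeL1 sizeS1; rewrite size_Pseq sr size_XsubC => sizeL1 sizeS1.
have : (r * size S1 <= r * (size S0).+1)%N by rewrite leq_mul2l; apply/orP; right; lia.
by rewrite mulnS; lia.
Qed.

(** * Divisibility and uniqueness for minimal polynomials *)

Lemma is_minpoly_rdvd Om p q : is_minpoly sigma delta Om p ->
  Ideal sigma delta Om q -> p %r| q.
Proof.
move=> [[Ip pM minp]|[-> q0]] Iq; last by rewrite (q0 q Iq); apply: rdvd0.
have [h [t [def_q lt_tp]]] := skew_div q (monic_neq0 pM).
have [t0|t0] := eqVneq t 0; first by exists h; rewrite def_q t0 addr0.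
suff /minp/(_ t0) : Ideal sigma delta Om t by rewrite leqNgt lt_tp.
move=> Q OQ; have -> : t = q - h ** p by rewrite def_q addrC addKr.
by apply: rdvdB; [apply: Iq | apply: rdvd_mull; apply: Ip].
Qed.

Lemma is_minpoly_uniq Om p q :
  is_minpoly sigma delta Om p -> is_minpoly sigma delta Om q -> p = q.
Proof.
move=> mp mq; have [[Iq qM minq]|[q0 q0']] := mq; last first.
  case: mp => [[/q0' p0 pM _]|[-> _]] //.
  by move: (monic_neq0 pM); rewrite p0 eqxx.
have [[Ip pM minp]|[_ p0']] := mp; last first.
  by move: (monic_neq0 qM); rewrite (p0' q Iq) eqxx.
apply: rdvd_monic_eq => //; first exact: is_minpoly_rdvd mq Ip.
by apply: minp => //; apply: monic_neq0.
Qed.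

Lemma splits_class_minpoly a w : splits_class a w ->
  is_minpoly sigma delta (linpolys (cls a)) (prod_lin w).
Proof.
case=> _ rw wI; left; split; [by rewrite linpolysP | exact: monic_Pseq |].
by move=> q /linpolysP/wI/rdvd_size.
Qed.

(** * Degree counts for a fixed class and a fixed basis *)

Section MainArgument.
Variables (a : F) (r : nat) (w as_ : seq F).
Hypothesis all_alg : forall c, algebraic sigma delta (linpolys (cls c)).
Hypothesis aw : splits_class a w.
Hypothesis as_cls : forall c, c \in as_ -> cls a c.
Hypothesis as_min : forall S,
  S != 0 -> (forall c, c \in as_ -> isroot S c) -> (size (prod_lin w) <= size S)%N.

Local Notation W := (prod_lin w).

Lemma size_splits_exp : size (W ^** r) = (r * size w).+1.
Proof. by rewrite size_skew_exp ?monic_Pseq // size_Pseq. Qed.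

(** Run the greedy construction from [L0 = S0 = 1]: [S] vanishes on the basis, so its degree is at
    least deg P, and [L], a right divisor of [H], has degree at least r deg P. *)
Lemma minpoly_family H : H != 0 ->
  (forall c, c \in as_ -> exists s : seq F,
     [/\ mseq s, size s = r, head 0 s = c & prod_lin s %r| H]) ->
  (size (W ^** r) <= size H)%N.
Proof.
move=> H0 asH; have one0 : 1 != 0 :> {poly F} := oner_neq0 _.
have [||L [S [LH S0 _ rS le]]] := mult_seq_greedy one0 one0 _ _ asH => //.
  by exists H; rewrite skew_mul1r.
have := leq_mul (leqnn r) (as_min S0 rS); rewrite size_splits_exp.
have := rdvd_size LH H0; rewrite size_Pseq size_poly1 in le *.
by rewrite mulnS; lia.
Qed.

(** The greedy construction starts from [prod_lin s] and the linear polynomial of its root. It gives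
    size s + r (deg P - 1) <= deg L <= r deg P. *)
Lemma mult_seq_size_rdvd_exp (s : seq F) :
  mseq s -> prod_lin s %r| W ^** r -> (0 < r)%N ->
  cls a (head 0 s) /\ (size s <= r)%N.
Proof.
move=> [s0 sh] sW r0.
have as0 : cls a (head 0 s).
  exact: isroot_splits_exp aw (rdvd_trans (isroot_Pseq_head s0) sW).
split=> //.
(* Sequences of length [r] over the basis are built by extension and divide [W ^** r] by part
   (1). *)
have asW c : c \in as_ -> exists s : seq F,
     [/\ mseq s, size s = r, head 0 s = c & prod_lin s %r| W ^** r].
  move=> /as_cls ac; have [b [bm sb hb]] := mult_seq_exists r.-1 aw ac.
  rewrite prednK // in sb; exists b; split=> //.
  by apply: (mult_seq_rdvd_exp all_alg aw); rewrite ?hb ?sb.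
have W0 : W ^** r != 0 by rewrite (monic_neq0 (monic_skew_exp r (monic_Pseq w))).
have [|L [S [LH S0 _ rS le]]] := mult_seq_greedy (Pseq_neq0 s) (lin_neq0 (head 0 s)) sW _ asW.
  by move=> y /sh->; apply: rdvd_refl.
have := leq_mul (leqnn r) (as_min S0 rS); have := rdvd_size LH W0.
move: le; rewrite size_splits_exp !size_Pseq size_XsubC mulnS.
by lia.
Qed.

Lemma splits_exp_neq0 : W ^** r != 0.
Proof. exact: monic_neq0 (monic_skew_exp r (monic_Pseq w)). Qed.

Lemma Crank_rdvd_exp Q : Crank sigma delta a r Q -> Q %r| W ^** r.
Proof. by case=> s [sm sa sr ->]; apply: mult_seq_rdvd_exp all_alg aw sm sa sr. Qed.

(** Part (1) puts [W ^** r] in the ideal and [minpoly_family] bounds degrees below. Leaving [Om]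
    abstract covers both [Crank] and the family of part (2). *)
Lemma is_minpoly_exp (Om : {poly F} -> Prop) :
    (forall Q, Om Q -> Crank sigma delta a r Q) ->
    (forall c, c \in as_ -> exists s : seq F,
       [/\ mseq s, size s = r, head 0 s = c & Om (prod_lin s)]) ->
  is_minpoly sigma delta Om (W ^** r).
Proof.
move=> OmC asOm; left; split; last 1 first.
- move=> H OmH H0; apply: minpoly_family => // c /asOm[s [sm sr sc Os]].
  by exists s; split=> //; apply: OmH.
- by move=> Q /OmC; apply: Crank_rdvd_exp.
- exact: monic_skew_exp (monic_Pseq w).
Qed.

(** Since [W ^** r] generates the ideal, membership means right dividing it, and the degree count
    bounds the length of the sequence. *)
Lemma Z_U2_Crank Om Q : (0 < r)%N -> is_minpoly sigma delta Om (W ^** r) ->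
  Z_U2 sigma delta (Ideal sigma delta Om) Q <-> Crank sigma delta a r Q.
Proof.
move=> r0 mO; split=> [[[s sm ->] dvdO]|CQ].
  have [as0 sr] : cls a (head 0 s) /\ (size s <= r)%N.
    apply: mult_seq_size_rdvd_exp => //; apply: dvdO.
    by case: mO => [[]//|[W0]]; move: splits_exp_neq0; rewrite W0 eqxx.
  by exists s.
split=> [|G /(is_minpoly_rdvd mO)]; last exact: rdvd_trans (Crank_rdvd_exp CQ).
by case: CQ => s [sm _ _ ->]; exists s.
Qed.

Lemma is_minpoly_Crank : (0 < r)%N ->
  is_minpoly sigma delta (Crank sigma delta a r) (W ^** r).
Proof.
move=> r0; apply: is_minpoly_exp => // c /as_cls ac.
have [b [bm sb hb]] := mult_seq_exists r.-1 aw ac.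
rewrite prednK // in sb; exists b; split=> //.
by exists b; split; rewrite ?sb ?hb.
Qed.

Lemma pbasis_family (A : nat -> seq F) : (0 < r)%N -> uniq as_ -> size as_ = size w ->
    (forall i, (i < size as_)%N ->
       [/\ mseq (A i), size (A i) = r & head 0 (A i) = nth 0 as_ i]) ->
  let Omega := [seq prod_lin (A i) | i <- iota 0 (size as_)] in
  is_minpoly sigma delta (fun Q => Q \in Omega) (W ^** r) /\
  pbasis_of sigma delta Omega (Crank sigma delta a r).
Proof.
move=> r0 as_uniq as_w hA Omega.
have OmC Q : Q \in Omega -> Crank sigma delta a r Q.
  case/mapP=> i; rewrite mem_iota => /= lt_i ->; have [Am Ar Ah] := hA i lt_i.
  by exists (A i); split; rewrite ?Ar // Ah; apply: as_cls; rewrite mem_nth.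
have mO : is_minpoly sigma delta (fun Q => Q \in Omega) (W ^** r).
  apply: is_minpoly_exp => // c c_as; have lt_c : (index c as_ < size as_)%N by rewrite index_mem.
  have [Am Ar Ah] := hA _ lt_c; exists (A (index c as_)).
  split; rewrite ?Ah ?nth_index //.
  by apply/mapP; exists (index c as_); rewrite ?mem_iota.
split=> //; split; last by move=> Q; apply: Z_U2_Crank.
  split; first by exists (W ^** r); [move=> Q /OmC; apply: Crank_rdvd_exp | apply: splits_exp_neq0].
  exists (W ^** r); split=> //.
  rewrite undup_id; last first.
    (* Equal products share their only root, so the basis entries agree, hence the indices. *)
    rewrite map_inj_in_uniq ?iota_uniq // => i j; rewrite !mem_iota /= !add0n => li lj eqA.
    have [[Ami Ari Ahi] [[_ Amj] _ Ahj]] := (hA i li, hA j lj).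
    have := Amj (head 0 (A i)); rewrite -eqA => /(_ (isroot_Pseq_head _)).
    rewrite Ari Ahi Ahj => /(_ r0)/eqP; by rewrite nth_uniq // => /eqP.
  rewrite big_map /deg size_splits_exp /= -as_w.
  rewrite (eq_big_seq (fun=> r)) => [|i]; first by rewrite big_const_seq count_predT iter_addn_0 size_iota mulnC.
  by rewrite mem_iota => /hA[_ Ar _]; rewrite size_Pseq Ar.
(* [Omega] lies inside [Crank], so each list dominates itself. *)
move=> s s_uniq sO; exists s; split=> // [Q /sO/OmC//|i _]; exact: rdvd_refl.
Qed.

End MainArgument.

Lemma is_minpoly_ext Om Om' p : (forall Q, Om Q <-> Om' Q) ->
  is_minpoly sigma delta Om p -> is_minpoly sigma delta Om' p.
Proof.
move=> eqO; have eqI q : Ideal sigma delta Om q <-> Ideal sigma delta Om' q.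
  by split=> Iq Q /eqO; apply: Iq.
case=> [[/eqI Ip pM minp]|[p0 Ip]]; [left | right]; split=> // q /eqI; [exact: minp|exact: Ip].
Qed.

(** P-independence fixes the degree of some minimal polynomial, and uniqueness carries it to [p].
    This identifies deg P with the number of basis elements. *)
Lemma pindep_lin_size (l : seq F) p : uniq l ->
    pindep sigma delta [seq lin c | c <- l] ->
    is_minpoly sigma delta (linpolys (fun c => c \in l)) p -> deg p = size l.
Proof.
move=> l_uniq [_ [G [mG dG]]] mp.
have linE Q : Q \in [seq lin c | c <- l] <-> linpolys (fun c => c \in l) Q.
  by split=> [/mapP[c lc ->]|[c lc ->]]; [exists c | apply: map_f].
have lin_inj : injective (fun c => lin c).
  by move=> b c /= eq_bc; apply: isroot_lin; rewrite eq_bc; apply: rdvd_refl.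
rewrite (is_minpoly_uniq mp (is_minpoly_ext linE mG)) dG undup_id ?map_inj_uniq //.
by rewrite big_map; under eq_bigr do rewrite /deg size_XsubC; rewrite sum1_size.
Qed.


End SkewTheory.

Theorem mainTheorem15 (F : unitRingType) (sigma : {rmorphism F -> F})
  (delta : F -> F)
  (Fdiv : forall x : F, x != 0 -> x \is a GRing.unit)
  (deltaD : forall x y : F, delta (x + y) = delta x + delta y)
  (deltaM : forall x y : F, delta (x * y) = sigma x * delta y + delta x * y)
  (all_alg : forall c : F,
     algebraic sigma delta (linpolys (conj_class sigma delta c)))
  (a : F) (r : nat) (r_gt0 : (0 < r)%N) (P : {poly F})
  (HP : is_minpoly sigma delta (linpolys (conj_class sigma delta a)) P)
  (as_ : seq F) (Has : pbasis_class sigma delta as_ a) :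
  [/\ (* (1) *)
      (forall b : seq F, mult_seq sigma delta b -> size b = r ->
         conj_class sigma delta a (head 0 b) ->
         rdvd sigma delta (Pseq sigma delta b) (skew_exp sigma delta P r)),
      (* (3): C_r(a) is a subset of U_2, P-closed, with minimal polynomial P^r *)
      (forall Q, Crank sigma delta a r Q -> U2 sigma delta Q) /\
      pclosed sigma delta (Crank sigma delta a r),
      is_minpoly sigma delta (Crank sigma delta a r) (skew_exp sigma delta P r),
      (* rank *)
      deg (skew_exp sigma delta P r) = (r * deg P)%N &
      (* (2) and the P-basis part of (3) *)
      forall A : nat -> seq F,
        (forall i, (i < size as_)%N ->
           [/\ mult_seq sigma delta (A i), size (A i) = r &
               head 0 (A i) = nth 0 as_ i]) ->
        let Omega := [seq Pseq sigma delta (A i) | i <- iota 0 (size as_)] in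
        is_minpoly sigma delta (fun Q => Q \in Omega) (skew_exp sigma delta P r) /\
        pbasis_of sigma delta Omega (Crank sigma delta a r)].

Proof.
have [w aw] := minpoly_split Fdiv deltaD deltaM (all_alg a).
(* By uniqueness [P] may be replaced by its factored form [Pseq sigma delta w]. *)
have Pw := is_minpoly_uniq Fdiv deltaD deltaM HP (splits_class_minpoly Fdiv deltaD aw).
subst P; have [as_uniq as_cls as_indep as_minE] := Has.
have as_mp := (as_minE _).2 HP.
have as_w : size as_ = size w.
  have := pindep_lin_size Fdiv deltaD deltaM as_uniq as_indep as_mp.
  by rewrite /deg size_Pseq.
have as_min S : S != 0 -> (forall c, c \in as_ -> rdvd sigma delta ('X - c%:P) S) ->
    (size (Pseq sigma delta w) <= size S)%N.
  move=> S0 /linpolysP IS.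
  case: as_mp => [[_ _]|[W0 _]]; first exact.
  by rewrite W0 size_poly0.
split.
- move=> b bm br ab; apply: (mult_seq_rdvd_exp Fdiv deltaD deltaM all_alg aw) => //.
  by rewrite br.
- split=> [Q [s [sm _ _ ->]]|Q]; first by exists s.
  apply: (Z_U2_Crank Fdiv deltaD deltaM all_alg aw as_cls as_min) => //.
  by apply: is_minpoly_Crank aw as_cls as_min _.
- by apply: is_minpoly_Crank aw as_cls as_min _.
- by rewrite /deg size_splits_exp // size_Pseq.
- by move=> A hA; apply: (pbasis_family Fdiv deltaD deltaM all_alg aw).
Qed.
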